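(* Let $\Gamma$ be a finite, simple, connected, regular graph with diameter $D$ and distinct adjacency eigenvalues $\lambda_0>\lambda_1>\cdots>\lambda_d$. Let $0\le h\le D$ and suppose that $\langle p_h(A),A_i\rangle=0$ for $i=0,\dots,h-1$. Then $\overline{\delta}_h\ge p_h(\lambda_0)$, with equality if and only if $\Gamma$ is $h$-punctually distance-regular.
   Context: $A$ is the adjacency matrix of $\Gamma$, $n$ the number of vertices, $m_i$ the multiplicity of $\lambda_i$, $\partial(u,v)$ the distance. The distance-$i$ matrix $A_i$ ($0\le i\le D$) has $(A_i)_{uv}=1$ if $\partial(u,v)=i$ and $0$ otherwise; $\overline{\delta}_h=\frac1n\sum_{u,v}(A_h)_{uv}$ is the average degree of the distance-$h$ graph. For symmetric matrices $R,S$, $\langle R,S\rangle=\frac1n\operatorname{tr}(RS)$. On the space $\mathbb{R}_d[x]$ of real polynomials of degree at most $d$, $\langle p,q\rangle=\frac1n\operatorname{tr}(p(A)q(A))=\frac1n\sum_{i=0}^d m_ip(\lambda_i)q(\lambda_i)$. The predistance polynomials $p_0,\dots,p_d$ are the unique polynomials with $\deg p_i=i$, $\langle p_i,p_j\rangle=0$ for $i\ne j$, and $\langle p_i,p_i\rangle=p_i(\lambda_0)$. $\Gamma$ is $h$-punctually distance-regular if $A_h=q_h(A)$ for some polynomial $q_h\in\mathbb{R}_d[x]$ with $\deg q_h=h$. *)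

(* Defs.v *)
From mathcomp Require Import all_boot all_order all_algebra.
From mathcomp Require Import reals.

Set Implicit Arguments.
Unset Strict Implicit.
Unset Printing Implicit Defensive.

Import Order.TTheory GRing.Theory Num.Theory.
Local Open Scope ring_scope.

Section Graph.
Variables (V : finType) (e : rel V).

Definition simple_graph : Prop := symmetric e /\ irreflexive e.

Definition connected : Prop := forall x y : V, connect e x y.

Definition regular : Prop :=
  exists k : nat, forall x : V, #|[set y | e x y]| = k.

Definition has_walk (k : nat) (x y : V) : bool :=
  [exists p : k.-tuple V, path e x p && (last x p == y)].

(* The least k < #|V| admitting a walk of length k from x to y; the default
   value is #|V|, which only occurs when x and y are not connected. *)
Definition gdist (x y : V) : nat :=
  find (fun k => has_walk k x y) (iota 0 #|V|).

Lemma gdist_walk (x y : V) : connect e x y -> has_walk (gdist x y) x y.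
Proof.
case/connectP=> p0 ep0 ->; case/shortenP: ep0 => p ep up _.
have hp : has_walk (size p) x (last x p).
  by apply/existsP; exists (in_tuple p); rewrite ep eqxx.
have sp : (size p < #|V|)%N by rewrite -[(size p).+1]/(size (x :: p)) -(card_uniqP up) max_card.
have hs : has (fun k => has_walk k x (last x p)) (iota 0 #|V|).
  by apply/hasP; exists (size p); rewrite ?mem_iota.
have := nth_find 0%N hs; rewrite nth_iota ?add0n //.
by move: hs; rewrite has_find size_iota.
Qed.

Lemma gdist_min (x y : V) (k : nat) : has_walk k x y -> (gdist x y <= k)%N.
Proof.
move=> hk; rewrite leqNgt; apply/negP=> lt.
have := before_find 0%N lt; rewrite nth_iota ?add0n ?hk //.
by apply: leq_trans lt _; rewrite -[X in (_ <= X)%N](size_iota 0) find_size.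
Qed.

Definition diameter : nat := \max_(x : V) \max_(y : V) gdist x y.

End Graph.

(* Matrices are indexed by 'I_n.+1 through an enumeration v of the vertices,
   which is a bijection in every use. *)
Section Matrices.
Variables (R : realType) (V : finType) (e : rel V) (n : nat).
Variable v : 'I_n.+1 -> V.

Definition adj_mx : 'M[R]_n.+1 := \matrix_(i, j) (e (v i) (v j))%:R.

Definition dist_mx (k : nat) : 'M[R]_n.+1 :=
  \matrix_(i, j) (gdist e (v i) (v j) == k)%:R.

Definition avg_degree (k : nat) : R :=
  (n.+1%:R)^-1 * \sum_(i < n.+1) \sum_(j < n.+1) dist_mx k i j.

Definition punctually_distance_regular (d h : nat) : Prop :=
  exists q : {poly R},
    [/\ (size q <= d.+1)%N, size q = h.+1 & dist_mx h = horner_mx adj_mx q].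

End Matrices.

Section Spectrum.
Variables (R : realType) (n : nat).

Definition mxdot (B C : 'M[R]_n.+1) : R := (n.+1%:R)^-1 * \tr (B *m C).

Variable A : 'M[R]_n.+1.

Definition polydot (p q : {poly R}) : R :=
  mxdot (horner_mx A p) (horner_mx A q).

Definition distinct_eigenvalues (d : nat) (lambda : 'I_d.+1 -> R) : Prop :=
  (forall i j : 'I_d.+1, (i < j)%N -> lambda j < lambda i) /\
  (forall x : R, eigenvalue A x <-> exists i : 'I_d.+1, x = lambda i).

(* Only p 0, ..., p d are constrained; these conditions determine them. *)
Definition predistance_polys (d : nat) (lambda : 'I_d.+1 -> R)
    (p : nat -> {poly R}) : Prop :=
  [/\ forall i, (i <= d)%N -> size (p i) = i.+1,
      forall i j, (i <= d)%N -> (j <= d)%N -> i <> j ->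
        polydot (p i) (p j) = 0 &
      forall i, (i <= d)%N -> polydot (p i) (p i) = (p i).[lambda ord0]].

End Spectrum.

(* Main.v *)
(* Since A has constant row sums lambda_0, the entries of p_h(A) add up to
   n p_h(lambda_0), i.e. <p_h(A), J> = p_h(lambda_0), where J = sum_i A_i.  The
   terms with i < h vanish by hypothesis and those with i > h because p_h has
   degree h, so <p_h(A), A_h> = p_h(lambda_0) = <p_h(A), p_h(A)>.  As
   <A_h, A_h> is the average degree delta_h, this gives
   |A_h - p_h(A)|^2 = delta_h - p_h(lambda_0), hence the inequality, and in the
   case of equality A_h = p_h(A).  Conversely, if A_h = q(A) with deg q = h,
   choose c with r = q - c p_h of degree < h; r(A) is orthogonal to both A_h and
   p_h(A), so r(A) = 0 and A_h = c p_h(A); pairing this with p_h(A) and with A_h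
   yields p_h(lambda_0) = c p_h(lambda_0) = delta_h.  The degree of p_h is only
   prescribed for h <= d; this follows from D <= d, since the product of the
   X - lambda_i, of degree d + 1, annihilates the symmetric matrix A. *)
Require Import Defs.
From mathcomp Require Import all_boot all_order all_algebra.
From mathcomp Require Import reals complex.

Set Implicit Arguments.
Unset Strict Implicit.
Unset Printing Implicit Defensive.

Import Order.TTheory GRing.Theory Num.Theory.

Local Open Scope ring_scope.

(** * Walks and distances *)

Lemma has_walk0 (V : finType) (e : rel V) (x y : V) :
  has_walk e 0 x y = (x == y).
Proof.
apply/existsP/eqP => [[p]|->]; first by rewrite (tuple0 p) => /eqP.
by exists [tuple]; rewrite /= eqxx.
Qed.

Lemma has_walkS (V : finType) (e : rel V) (k : nat) (x y : V) :
  has_walk e k.+1 x y = [exists z, e x z && has_walk e k z y].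
Proof.
apply/existsP/existsP => [[p]|[z /andP[exz /existsP[p /andP[ep lp]]]]].
  case/tupleP: p => z p /= /andP[/andP[exz ep] lp].
  by exists z; rewrite exz; apply/existsP; exists p; rewrite ep.
by exists [tuple of z :: p]; rewrite /= exz ep.
Qed.

Lemma has_walk_sym (V : finType) (e : rel V) (k : nat) (x y : V) :
  symmetric e -> has_walk e k x y -> has_walk e k y x.
Proof.
move=> e_sym /existsP[p /andP[ep /eqP lp]].
(* [p] omits the start [x] of the walk; the reversed walk must omit its start [y], hence
   [belast]. *)
apply/existsP; exists [tuple of rev (belast x p)].
rewrite /= -lp rev_path (eq_path (e' := e)) ?ep => [|? ?]; last exact: e_sym.
by case: (tval p) => [|z s] //=; rewrite rev_cons last_rcons eqxx.
Qed.

Lemma gdist_sym (V : finType) (e : rel V) (x y : V) :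
  symmetric e -> gdist e x y = gdist e y x.
Proof.
move=> e_sym; apply: eq_find => k /=.
by apply/idP/idP; apply: has_walk_sym.
Qed.

Lemma gdist_le_card (V : finType) (e : rel V) (x y : V) :
  (gdist e x y <= #|V|)%N.
Proof. by rewrite -[X in (_ <= X)%N](size_iota 0); apply: find_size. Qed.

(** * Powers and polynomials of the adjacency matrix *)

Lemma adj_mx_sym (R : realType) (V : finType) (e : rel V) (n : nat)
  (v : 'I_n.+1 -> V) : symmetric e -> (adj_mx R e v)^T = adj_mx R e v.
Proof. by move=> e_sym; apply/matrixP => i j; rewrite !mxE e_sym. Qed.

Lemma dist_mx_sym (R : realType) (V : finType) (e : rel V) (n : nat)
  (v : 'I_n.+1 -> V) (k : nat) :
  symmetric e -> (dist_mx R e v k)^T = dist_mx R e v k.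
Proof.
by move=> e_sym; apply/matrixP => i j; rewrite !mxE gdist_sym.
Qed.

Lemma trmx_horner_mx (R : comNzRingType) (n : nat) (A : 'M[R]_n.+1)
  (q : {poly R}) : (horner_mx A q)^T = horner_mx A^T q.
Proof.
elim/poly_ind: q => [|q c IHq]; first by rewrite !rmorph0 trmx0.
rewrite !rmorphD !rmorphM /= !horner_mx_X !horner_mx_C linearD /=.
rewrite tr_scalar_mx trmx_mul IHq; congr (_ + _).
exact/comm_mx_sym/comm_horner_mx.
Qed.

Lemma adj_expr_ge0 (R : realType) (V : finType) (e : rel V) (n : nat)
  (v : 'I_n.+1 -> V) (k : nat) (i j : 'I_n.+1) :
  0 <= (adj_mx R e v ^+ k) i j.
Proof.
elim: k i j => [|k IHk] i j; first by rewrite expr0 mxE ler0n.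
by rewrite exprS mxE sumr_ge0 // => l _; rewrite mulr_ge0 // mxE ler0n.
Qed.

(** All terms of the matrix product are nonnegative, so an entry vanishes only if each term does;
    this gives an induction on [k] without counting walks. *)
Lemma adj_expr_eq0 (R : realType) (V : finType) (e : rel V) (n : nat)
  (v : 'I_n.+1 -> V) (k : nat) (i j : 'I_n.+1) : bijective v ->
  ((adj_mx R e v ^+ k) i j == 0) = ~~ has_walk e k (v i) (v j).
Proof.
move=> v_bij; have [w vK wK] := v_bij.
elim: k i j => [|k IHk] i j.
  by rewrite expr0 mxE has_walk0 (bij_eq v_bij) pnatr_eq0 eqb0.
rewrite exprS mxE psumr_eq0 => [|l _]; last first.
  by rewrite mulr_ge0 ?adj_expr_ge0 // mxE ler0n.
rewrite has_walkS negb_exists; apply/allP/forallP => [H x|H l _].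
  have /= := H (w x) (mem_index_enum _).
  by rewrite mulf_eq0 IHk wK mxE wK pnatr_eq0 eqb0 negb_and.
by rewrite /= mulf_eq0 IHk mxE pnatr_eq0 eqb0 -negb_and.
Qed.

(** Each monomial of [q] has degree below the distance, and no walk that short joins the two
    vertices. *)
Lemma horner_adj_eq0 (R : realType) (V : finType) (e : rel V) (n : nat)
  (v : 'I_n.+1 -> V) (q : {poly R}) (i j : 'I_n.+1) : bijective v ->
  (size q <= gdist e (v i) (v j))%N -> horner_mx (adj_mx R e v) q i j = 0.
Proof.
move=> v_bij sq; rewrite -[q]coefK poly_def rmorph_sum summxE big1 // => k _.
rewrite /= horner_mxZ rmorphXn /= horner_mx_X mxE; apply/eqP.
rewrite mulf_eq0 adj_expr_eq0 //; apply/orP; right; apply/negP => /gdist_min.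
by rewrite leqNgt (leq_trans (ltn_ord k) sq).
Qed.

(* If g = d(x, y) >= deg q, then A^g agrees with (X^g mod q)(A), whose (x, y)
   entry is zero for degree reasons, although a walk of length g exists. *)
Lemma diameter_lt_annihilator (R : realType) (V : finType) (e : rel V)
  (n : nat) (v : 'I_n.+1 -> V) (q : {poly R}) : bijective v -> connected e ->
  q != 0 -> horner_mx (adj_mx R e v) q = 0 -> (diameter e < (size q).-1)%N.
Proof.
move=> v_bij e_conn q0 Aq; have [w vK wK] := v_bij.
have dist_lt (x y : V) : (gdist e x y < (size q).-1)%N.
  rewrite ltnNge; apply/negP => le_q.
  have : (adj_mx R e v ^+ gdist e x y) (w x) (w y) == 0.
    rewrite -[adj_mx R e v]horner_mx_X -rmorphXn /=
      (divp_eq 'X^(gdist e x y) q) rmorphD rmorphM /= Aq.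
    rewrite mulr0 add0r horner_adj_eq0 // !wK (leq_trans _ le_q) //.
    by rewrite -ltnS prednK ?size_poly_gt0 // ltn_modp.
  by rewrite adj_expr_eq0 // !wK gdist_walk.
(* With deg q positive, the strict bound on each distance becomes a bound by deg q - 1, which passes
   to the maximum. *)
have q_gt0 : (0 < (size q).-1)%N by apply: leq_ltn_trans (dist_lt (v ord0) (v ord0)).
rewrite -(prednK q_gt0) ltnS; apply/bigmax_leqP => x _; apply/bigmax_leqP => y _.
by rewrite -ltnS prednK.
Qed.

(** * Eigenvalues of a symmetric matrix and the bound D <= d *)

(* Over R[i], A is unitarily diagonalizable with real eigenvalues, and these are
   already eigenvalues over R. *)
Lemma sym_horner_eigenvalues (R : realType) (n : nat) (A : 'M[R]_n.+1)
  (d : nat) (lambda : 'I_d.+1 -> R) : A^T = A ->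
  (forall x : R, eigenvalue A x -> exists i, x = lambda i) ->
  horner_mx A (\prod_i ('X - (lambda i)%:P)) = 0.
Proof.
move=> A_sym eigA; set Q := \prod_i _.
pose f : {rmorphism R -> R[i]%C} := real_complex R.
pose Af := map_mx f A.
have Af_herm : Af \is hermsymmx.
  apply/is_hermitianmxP; rewrite expr0 scale1r; apply/matrixP => i j.
  rewrite !mxE -[in LHS]A_sym mxE.
  by apply/esym/CrealP/complex_realP; exists (A j i).
have /orthomx_spectralP := hermitian_normalmx Af_herm.
have := hermitian_spectral_diag_real Af_herm.
have := spectral_unit Af.
set P := spectralmx _; set s := spectral_diag _ => Pu s_real AfE.
apply: (map_mx_inj (f := f)); rewrite map_horner_mx map_mx0 -/Af AfE.
rewrite horner_mx_uconjC // horner_mx_diag.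
suff -> : map_mx (horner (map_poly f Q)) s = 0 by rewrite linear0 mulmx0 mul0mx.
apply/rowP => j; rewrite !mxE.
have /complex_realP[x sjx] := mxOverP s_real 0 j.
rewrite sjx horner_map.
suff /eigA [i ->] : eigenvalue A x.
  by rewrite /Q horner_prod (bigD1 i) //= !hornerE subrr mul0r.
rewrite -(eigenvalue_map f) -/Af; apply/eigenvalueP.
(* As A = P^-1 diag(s) P, the rows of P are left eigenvectors; they are nonzero because P is
   invertible. *)
exists (row j P).
  rewrite {1}AfE -!mulmxA -row_mul !mulmxA mulmxV // mul1mx row_mul row_diag_mx.
  by rewrite sjx -scalemxAl -rowE.
apply/eqP => Pj.
have /rowP/(_ j) : row j (P *m invmx P) = 0 by rewrite row_mul Pj mul0mx.
by rewrite mulmxV // !mxE eqxx => /eqP; rewrite oner_eq0.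
Qed.

Lemma diameter_le_eigenvalues (R : realType) (V : finType) (e : rel V)
  (n : nat) (v : 'I_n.+1 -> V) (d : nat) (lambda : 'I_d.+1 -> R) :
  bijective v -> connected e -> symmetric e ->
  distinct_eigenvalues (adj_mx R e v) lambda -> (diameter e <= d)%N.
Proof.
move=> v_bij e_conn e_sym [_ eigA].
have := sym_horner_eigenvalues (adj_mx_sym R v e_sym)
  (fun x => proj1 (eigA x)).
move/(diameter_lt_annihilator v_bij e_conn).
rewrite size_prod_XsubC [index_enum _]unlock -enumT size_enum_ord ltnS; apply.
by apply/monic_neq0/monic_prod_XsubC.
Qed.

(** * The largest eigenvalue and the row sums of a regular graph *)

(* Compare the entries of u A = a u at an index where |u_j| is maximal. *)
Lemma eigenvalue_le_col_sum (R : realType) (n : nat) (A : 'M[R]_n.+1) (a k : R) :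
  (forall j, \sum_i `|A i j| <= k) -> eigenvalue A a -> `|a| <= k.
Proof.
move=> Ak /eigenvalueP[u uA u0].
case: (@arg_maxP _ _ _ (ord0 : 'I_n.+1) xpredT (fun j => `|u 0 j|) isT) => j _ j_max.
have jmax i : `|u 0 i| <= `|u 0 j| by apply: j_max.
have uj : 0 < `|u 0 j|.
  rewrite lt_neqAle normr_ge0 andbT eq_sym; apply: contra u0 => uj.
  apply/eqP/rowP => i; apply/eqP; rewrite mxE -normr_le0.
  by rewrite -(eqP uj) jmax.
rewrite -(ler_pM2r uj) -normrM.
have /rowP/(_ j) := uA; rewrite !mxE => <-.
apply: (le_trans (ler_norm_sum _ _ _)).
apply: le_trans (_ : \sum_i `|A i j| * `|u 0 j| <= _).
  by apply: ler_sum => i _; rewrite normrM mulrC ler_wpM2l // jmax.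
by rewrite -mulr_suml ler_wpM2r.
Qed.

Lemma adj_mx_row_sum (R : realType) (V : finType) (e : rel V) (n : nat)
  (v : 'I_n.+1 -> V) (i : 'I_n.+1) : bijective v ->
  \sum_j adj_mx R e v i j = #|[set y | e (v i) y]|%:R.
Proof.
move=> v_bij; rewrite -sum1dep_card natr_sum /=.
rewrite (reindex v) /=; last exact: onW_bij.
rewrite [RHS]big_mkcond /=.
by apply: eq_bigr => j _; rewrite mxE; case: ifP.
Qed.

(** The column sums [k] bound all eigenvalues, and [k] is itself one, with the all-ones row as
    eigenvector. *)
Lemma regular_eigenvalue_max (R : realType) (V : finType) (e : rel V)
  (n : nat) (v : 'I_n.+1 -> V) (d k : nat) (lambda : 'I_d.+1 -> R) :
  bijective v -> symmetric e -> (forall x, #|[set y | e x y]| = k) ->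
  distinct_eigenvalues (adj_mx R e v) lambda -> lambda ord0 = k%:R.
Proof.
move=> v_bij e_sym e_reg [lambda_dec eigA].
have col_sum j : \sum_i adj_mx R e v i j = k%:R.
  rewrite -(e_reg (v j)) -(adj_mx_row_sum R e j v_bij); apply: eq_bigr => i _.
  by rewrite !mxE e_sym.
apply/le_anti/andP; split.
  apply: le_trans (ler_norm _) _.
  apply: (@eigenvalue_le_col_sum R n (adj_mx R e v)) => [j|]; last first.
    by apply/eigA; exists ord0.
  by rewrite -(col_sum j) ler_sum // => i _; rewrite mxE normr_nat.
have /eigA[i ->] : eigenvalue (adj_mx R e v) k%:R.
  apply/eigenvalueP; exists (const_mx 1).
    apply/rowP => j; rewrite !mxE mulr1 -(col_sum j).
    by apply: eq_bigr => i _; rewrite mxE mul1r.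
  by apply/eqP => /rowP/(_ ord0)/eqP; rewrite !mxE oner_eq0.
have [i0|i_gt0] := posnP i; last exact/ltW/lambda_dec.
by rewrite (_ : i = ord0) //; apply/val_inj.
Qed.

(** The all-ones column is an eigenvector of [A] for [k], hence of q(A) for q(k). *)
Lemma horner_mx_row_sum (R : comNzRingType) (n : nat) (A : 'M[R]_n.+1) (k : R)
  (q : {poly R}) (i : 'I_n.+1) : (forall i, \sum_j A i j = k) ->
  \sum_j horner_mx A q i j = q.[k].
Proof.
move=> Ak; pose u : 'cV[R]_n.+1 := const_mx 1.
have row_sum (B : 'M[R]_n.+1) j : (B *m u) j 0 = \sum_l B j l.
  by rewrite mxE; apply: eq_bigr => l _; rewrite mxE mulr1.
have Au : A *m u = k *: u.
  by apply/colP => j; rewrite row_sum Ak !mxE mulr1.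
rewrite -row_sum; suff -> : horner_mx A q *m u = q.[k] *: u by rewrite !mxE mulr1.
elim/poly_ind: q => [|q c IHq]; first by rewrite rmorph0 horner0 mul0mx scale0r.
rewrite rmorphD rmorphM /= horner_mx_X horner_mx_C !hornerE mulmxDl -mulmxA Au.
by rewrite -scalemxAr IHq mul_scalar_mx scalerA scalerDl [k * _]mulrC.
Qed.

(** * The inner product of matrices *)

Lemma mxdotC (R : realType) (n : nat) (B C : 'M[R]_n.+1) :
  mxdot B C = mxdot C B.
Proof. by rewrite /mxdot mxtrace_mulC. Qed.

Lemma mxdotDl (R : realType) (n : nat) (B B' C : 'M[R]_n.+1) :
  mxdot (B + B') C = mxdot B C + mxdot B' C.
Proof. by rewrite /mxdot mulmxDl linearD mulrDr. Qed.

Lemma mxdotZl (R : realType) (n : nat) (a : R) (B C : 'M[R]_n.+1) :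
  mxdot (a *: B) C = a * mxdot B C.
Proof. by rewrite /mxdot -scalemxAl linearZ /= mulrCA. Qed.

Lemma mxdotBl (R : realType) (n : nat) (B B' C : 'M[R]_n.+1) :
  mxdot (B - B') C = mxdot B C - mxdot B' C.
Proof. by rewrite mxdotDl -scaleN1r mxdotZl mulN1r. Qed.

(** Turns the trace form into the entrywise inner product, from which positivity and the pairings
    with distance matrices are read off. *)
Lemma mxdot_symE (R : realType) (n : nat) (B C : 'M[R]_n.+1) : C^T = C ->
  mxdot B C = n.+1%:R^-1 * \sum_i \sum_j B i j * C i j.
Proof.
move=> C_sym; congr (_ * _); apply: eq_bigr => i _.
by rewrite mxE; apply: eq_bigr => j _; rewrite -[in LHS]C_sym mxE.
Qed.

Lemma mxdot_ge0 (R : realType) (n : nat) (B : 'M[R]_n.+1) :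
  B^T = B -> 0 <= mxdot B B.
Proof.
move=> B_sym; rewrite mxdot_symE // mulr_ge0 ?invr_ge0 ?ler0n //.
by apply: sumr_ge0 => i _; apply: sumr_ge0 => j _; rewrite -expr2 sqr_ge0.
Qed.

Lemma mxdot_eq0 (R : realType) (n : nat) (B : 'M[R]_n.+1) :
  B^T = B -> mxdot B B = 0 -> B = 0.
Proof.
move=> B_sym; rewrite mxdot_symE // => /eqP.
rewrite mulf_eq0 invr_eq0 pnatr_eq0 /= psumr_eq0 => [|i _]; last first.
  by apply: sumr_ge0 => j _; rewrite -expr2 sqr_ge0.
move=> /allP B0; apply/matrixP => i j; rewrite mxE; apply/eqP.
have := B0 i (mem_index_enum _); rewrite /= psumr_eq0 => [/allP/(_ j)|l _].
  by rewrite mem_index_enum mulf_eq0 orbb; apply.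
by rewrite -expr2 sqr_ge0.
Qed.

(** The distance matrices add up to the all-ones matrix. The range includes #|V|, the default value
    of [gdist], so that every pair lies in exactly one class. *)
Lemma mxdot_dist_sum (R : realType) (V : finType) (e : rel V) (n : nat)
  (v : 'I_n.+1 -> V) (B : 'M[R]_n.+1) : symmetric e ->
  \sum_(k < #|V|.+1) mxdot B (dist_mx R e v k) =
  n.+1%:R^-1 * \sum_i \sum_j B i j.
Proof.
move=> e_sym.
under eq_bigr => k _ do rewrite mxdot_symE ?dist_mx_sym //.
rewrite -mulr_sumr exchange_big /=; congr (_ * _).
apply: eq_bigr => i _; rewrite exchange_big /=; apply: eq_bigr => j _.
rewrite -mulr_sumr (bigD1 (inord (gdist e (v i) (v j)))) //= mxE.
rewrite inordK ?ltnS ?gdist_le_card // eqxx big1 ?addr0 ?mulr1 // => k ne.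
rewrite mxE; apply/eqP; rewrite pnatr_eq0 eqb0; apply: contra ne => /eqP ->.
by rewrite inord_val.
Qed.

(** The supports are disjoint: q(A) vanishes at all pairs at distance [k] > deg q. *)
Lemma mxdot_horner_dist_gt (R : realType) (V : finType) (e : rel V) (n : nat)
  (v : 'I_n.+1 -> V) (q : {poly R}) (k : nat) : bijective v -> symmetric e ->
  (size q <= k)%N ->
  mxdot (horner_mx (adj_mx R e v) q) (dist_mx R e v k) = 0.
Proof.
move=> v_bij e_sym sq; rewrite mxdot_symE ?dist_mx_sym //.
rewrite big1 ?mulr0 // => i _; rewrite big1 // => j _; rewrite mxE.
case: eqP => [dk|_]; last by rewrite mulr0.
by rewrite horner_adj_eq0 ?mul0r // dk.
Qed.

Lemma mxdot_dist_dist (R : realType) (V : finType) (e : rel V) (n : nat)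
  (v : 'I_n.+1 -> V) (k : nat) : symmetric e ->
  mxdot (dist_mx R e v k) (dist_mx R e v k) = avg_degree R e v k.
Proof.
move=> e_sym; rewrite mxdot_symE ?dist_mx_sym //; congr (_ * _).
apply: eq_bigr => i _; apply: eq_bigr => j _; rewrite !mxE.
by case: eqP; rewrite ?mulr1 ?mulr0.
Qed.

(** * Orthogonality of the predistance polynomials to lower degrees *)

Lemma size_sub_lead (R : fieldType) (q r : {poly R}) (m : nat) :
  size r = m.+1 -> (size q <= m.+1)%N -> (size (q - q`_m / r`_m *: r)%R <= m)%N.
Proof.
move=> sr sq; have rm : r`_m != 0.
  by rewrite -[m]/m.+1.-1 -sr -/(lead_coef r) lead_coef_eq0 -size_poly_eq0 sr.
apply/leq_sizeP => j; rewrite leq_eqVlt => /predU1P[<-|lt_mj].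
  by rewrite !coefE divfK ?subrr.
by rewrite !coefE [q`_j]nth_default ?(leq_trans sq) //
  [r`_j]nth_default ?sr // mulr0 subr0.
Qed.

(** Induction on a bound for the size of [q]: subtracting a multiple of [p m], itself orthogonal to
    [p h] for m < h, lowers that bound. *)
Lemma predistance_orth (R : realType) (n : nat) (A : 'M[R]_n.+1) (d : nat)
  (lambda : 'I_d.+1 -> R) (p : nat -> {poly R}) (h : nat) (q : {poly R}) :
  predistance_polys A lambda p -> (h <= d)%N -> (size q <= h)%N ->
  polydot A q (p h) = 0.
Proof.
move=> [size_p orth_p _] hd.
suff IH m : (m <= h)%N -> forall r : {poly R},
    (size r <= m)%N -> polydot A r (p h) = 0.
  exact: IH.
elim: m => [_ r|m IHm mh r sr].
  rewrite leqn0 size_poly_eq0 => /eqP ->.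
  by rewrite /polydot rmorph0 /mxdot mul0mx mxtrace0 mulr0.
have md : (m <= d)%N by apply: leq_trans hd; apply: ltnW.
have := IHm (ltnW mh) _ (size_sub_lead (size_p m md) sr).
rewrite /polydot rmorphB /= horner_mxZ mxdotBl mxdotZl.
rewrite [mxdot (horner_mx A (p m)) _]orth_p ?mulr0 ?subr0 //.
by apply/eqP; rewrite neq_ltn mh.
Qed.

(** * The inequality and the case of equality *)

Theorem proposition4p4 (R : realType) (V : finType) (e : rel V)
  (e_simple : simple_graph e) (e_connected : connected e)
  (e_regular : regular e)
  (n : nat) (v : 'I_n.+1 -> V) (v_bij : bijective v)
  (d : nat) (lambda : 'I_d.+1 -> R)
  (lambdaP : distinct_eigenvalues (adj_mx R e v) lambda)
  (p : nat -> {poly R})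
  (pP : predistance_polys (adj_mx R e v) lambda p)
  (h : nat) (h_le_diam : (h <= diameter e)%N)
  (p_h_orth : forall i : nat, (i < h)%N ->
    mxdot (horner_mx (adj_mx R e v) (p h)) (dist_mx R e v i) = 0) :
  (p h).[lambda ord0] <= avg_degree R e v h /\
  (avg_degree R e v h = (p h).[lambda ord0] <->
   punctually_distance_regular R e v d h).
Proof.
have [e_sym _] := e_simple; have [k e_reg] := e_regular.
have hd : (h <= d)%N.
  apply: leq_trans h_le_diam _.
  exact: diameter_le_eigenvalues v_bij e_connected e_sym lambdaP.
have lambda0 := regular_eigenvalue_max v_bij e_sym e_reg lambdaP.
have [size_p _ norm_p] := pP.
have horner_sym q : (horner_mx (adj_mx R e v) q)^T = horner_mx (adj_mx R e v) q.
  by rewrite trmx_horner_mx adj_mx_sym.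
have AhAh := mxdot_dist_dist R v h e_sym.
set Ah := dist_mx R e v h in AhAh *; set pA := horner_mx _ (p h) in p_h_orth.
set delta := avg_degree R e v h in AhAh *; set p0 := (p h).[lambda ord0].
have pApA : mxdot pA pA = p0 by apply: norm_p.
have pAAh : mxdot pA Ah = p0.
  have := mxdot_dist_sum v pA e_sym.
  have h_lt : (h < #|V|.+1)%N.
    rewrite ltnS (leq_trans h_le_diam) //; apply/bigmax_leqP => x _.
    by apply/bigmax_leqP => y _; apply: gdist_le_card.
  rewrite (bigD1 (Ordinal h_lt)) //= big1 ?addr0 => [->|i ne].
    rewrite (eq_bigr (fun=> p0)) => [|i _].
      by rewrite sumr_const card_ord -[p0 *+ _]mulr_natl mulKf ?pnatr_eq0.
    rewrite /p0 lambda0; apply: horner_mx_row_sum => j.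
    by rewrite adj_mx_row_sum // e_reg.
  have : (i != h :> nat) by [].
  rewrite neq_ltn => /orP[/p_h_orth //|h_lt_i].
  by rewrite mxdot_horner_dist_gt // size_p.
have B_sym : (Ah - pA)^T = Ah - pA by rewrite linearB /= horner_sym dist_mx_sym.
have normB : mxdot (Ah - pA) (Ah - pA) = delta - p0.
  rewrite mxdotBl ![mxdot _ (Ah - pA)]mxdotC !mxdotBl AhAh pAAh pApA.
  by rewrite mxdotC pAAh subrr subr0.
split; first by rewrite -subr_ge0 -normB mxdot_ge0.
split=> [delta_p0|[q [sq_d sq Ahq]]].
  exists (p h); rewrite size_p //; split=> //.
  apply/eqP; rewrite -subr_eq0; apply/eqP/mxdot_eq0 => //.
  by rewrite normB delta_p0 subrr.
pose c := q`_h / (p h)`_h; pose r := q - c *: p h.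
have sr : (size r <= h)%N by apply: size_sub_lead; rewrite ?size_p ?sq.
have rA : horner_mx (adj_mx R e v) r = Ah - c *: pA.
  by rewrite rmorphB /= horner_mxZ /Ah Ahq.
have rAh : mxdot (horner_mx (adj_mx R e v) r) Ah = 0.
  by apply: mxdot_horner_dist_gt.
have r_ph := predistance_orth pP hd sr.
have /eqP : horner_mx (adj_mx R e v) r = 0.
  (* Expanding only one factor, <r(A), r(A)> = <A_h, r(A)> - c <p_h(A), r(A)>, and both terms
     vanish. *)
  apply: (mxdot_eq0 (horner_sym r)); rewrite {2}rA mxdotC mxdotBl mxdotZl.
  by rewrite [mxdot Ah _]mxdotC rAh mxdotC [mxdot _ pA]r_ph mulr0 subrr.
rewrite rA subr_eq0 => /eqP Ahc.
have p0c : p0 = c * p0 by rewrite -{1}pAAh mxdotC Ahc mxdotZl pApA.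
by rewrite -AhAh {1}Ahc mxdotZl pAAh -p0c.
Qed.
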